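(* Let $H$ be a bipartite graph with no vertex of degree zero or one, with vertex set $S\uplus T$, $S=\{1,\dots,n\}$, $T=\{n+1,\dots,n+m\}$. Then the clique map $\phi:\mathcal{V}(H)\to\mathcal{C}(H)$ is well defined (i.e., $\phi(\mathbf{a})$ is a maximal clique of $G(H)$ with respect to the canonical bipartite framing for every clique vector $\mathbf{a}$) and is a bijection.
   Context: Every edge of $H$ joins a vertex of $S$ to a vertex of $T$; $N_H(v)$ denotes the neighborhood of $v$. The extension $G(H)$ is the directed multigraph obtained from $H$ (edges directed from $S$ to $T$) by adding vertices $s,t$; for each $i\in S$ two parallel edges $\alpha_{1,i},\alpha_{2,i}$ from $s$ to $i$; for each edge $ij$ of $H$ ($i\in S,j\in T$) the edge $\beta_{i,j}$ from $i$ to $j$; and for each $j\in T$ two parallel edges $\gamma_{j,1},\gamma_{j,2}$ from $j$ to $t$. A route is a directed path from $s$ to $t$; every route has the form $\alpha_{a,i}\beta_{i,j}\gamma_{j,b}$. The canonical bipartite framing orders the edges entering/leaving each inner vertex by $\alpha_{1,i}<\alpha_{2,i}$, $\gamma_{j,1}<\gamma_{j,2}$, $\beta_{i,j}<\beta_{i,k}$ if $j<k$, and $\beta_{j,i}<\beta_{k,i}$ if $j<k$. With respect to this framing, two routes are incoherent (in conflict) exactly when they are, for some indices, of one of the forms: (a) $\alpha_{1,i}\beta_{i,j}\gamma_{j,2}$ and $\alpha_{2,i}\beta_{i,j}\gamma_{j,1}$; (b) $\alpha_{1,i}\beta_{i,k}\gamma_{k,b}$ and $\alpha_{2,i}\beta_{i,j}\gamma_{j,b'}$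 with $j<k$; (c) $\alpha_{a,i}\beta_{i,j}\gamma_{j,2}$ and $\alpha_{a',i'}\beta_{i',j}\gamma_{j,1}$ with $i<i'$; otherwise they are coherent. A clique is a set of pairwise coherent routes; $\mathcal{C}(H)$ denotes the set of maximal (under inclusion) cliques. A clique vector is $\mathbf{a}=((a_v)_{v\in S\cup T},(a_{i,j})_{ij\in E(H)})$ with $a_v\in N_H(v)$ for every vertex $v$, and $a_{i,j}\in\{+,-\}$ where $a_{i,j}$ may equal $+$ only if $a_i=j$ and $a_j=i$ (otherwise $a_{i,j}=-$). $\mathcal{V}(H)$ is the set of clique vectors. The clique map $\phi$ sends $\mathbf{a}$ to the set of routes containing, for each edge $ij\in E(H)$ ($i\in S$, $j\in T$): (i) if $a_i\ne j$ and $a_j\ne i$: the single route $\alpha_{x,i}\beta_{i,j}\gamma_{j,y}$ with $x=2$ if $a_i<j$, $x=1$ if $a_i>j$, and $y=2$ if $a_j<i$, $y=1$ if $a_j>i$; (ii) if exactly one of $a_i=j$, $a_j=i$ holds: if $a_i=j$ and $a_j<i$, the routes $\alpha_{1,i}\beta_{i,j}\gamma_{j,2},\alpha_{2,i}\beta_{i,j}\gamma_{j,2}$; if $a_i=j$ and $a_j>i$, the routes $\alpha_{1,i}\beta_{i,j}\gamma_{j,1},\alpha_{2,i}\beta_{i,j}\gamma_{j,1}$; if $a_j=i$ and $a_i<j$, the routes $\alpha_{2,i}\beta_{i,j}\gamma_{j,1},\alpha_{2,i}\beta_{i,j}\gamma_{j,2}$; if $a_j=i$ and $a_i>j$, the routes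 $\alpha_{1,i}\beta_{i,j}\gamma_{j,1},\alpha_{1,i}\beta_{i,j}\gamma_{j,2}$; (iii) if $a_i=j$ and $a_j=i$: if $a_{i,j}=-$, the routes $\alpha_{1,i}\beta_{i,j}\gamma_{j,1},\alpha_{1,i}\beta_{i,j}\gamma_{j,2},\alpha_{2,i}\beta_{i,j}\gamma_{j,2}$; if $a_{i,j}=+$, the routes $\alpha_{1,i}\beta_{i,j}\gamma_{j,1},\alpha_{2,i}\beta_{i,j}\gamma_{j,1},\alpha_{2,i}\beta_{i,j}\gamma_{j,2}$. *)

(* Defs.v *)
From HB Require Import structures.
From mathcomp Require Import all_boot.
Set Implicit Arguments.
Unset Strict Implicit.
Unset Printing Implicit Defensive.

(* A simple bipartite graph on S + T is given by its edge set.  The element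
   i : 'I_n stands for the vertex i + 1 of S = {1, ..., n}, and j : 'I_m for the
   vertex n + 1 + j of T = {n + 1, ..., n + m}; both encodings preserve the
   order, and vertices of S are never compared with vertices of T. *)
Definition bipartite_graph (n m : nat) : predArgType := {set 'I_n * 'I_m}.

Section BipartiteGraph.

Context {n m : nat} (H : bipartite_graph n m).

Definition nbhS (i : 'I_n) : {set 'I_m} := [set j | (i, j) \in H].
Definition nbhT (j : 'I_m) : {set 'I_n} := [set i | (i, j) \in H].

Definition edge_of : predArgType := {ij : 'I_n * 'I_m | ij \in H}.
HB.instance Definition _ := Finite.on edge_of.
HB.instance Definition _ := SubType.on edge_of.

Definition endS (e : edge_of) : 'I_n := (val e).1.
Definition endT (e : edge_of) : 'I_m := (val e).2.

Variant vertex : predArgType :=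
  Source | Sink | VS of 'I_n | VT of 'I_m.

(* A boolean label stands for an index in {1, 2}: false is 1 and true is 2.
   [Alpha a i], [Beta e] and [Gamma j b] are the edges alpha_{a,i},
   beta_{endS e, endT e} and gamma_{j,b}. *)
Variant arc : predArgType :=
  Alpha of bool & 'I_n | Beta of edge_of | Gamma of 'I_m & bool.

Definition vertex_code (v : vertex) : bool + ('I_n + 'I_m) :=
  match v with
  | Source => inl false | Sink => inl true
  | VS i => inr (inl i) | VT j => inr (inr j)
  end.
Definition vertex_decode (c : bool + ('I_n + 'I_m)) : vertex :=
  match c with
  | inl b => if b then Sink else Source
  | inr (inl i) => VS i | inr (inr j) => VT j
  end.
Lemma vertex_codeK : cancel vertex_code vertex_decode.
Proof. by case. Qed.
HB.instance Definition _ := Finite.copy vertex (can_type vertex_codeK).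

Definition arc_code (f : arc) : bool * 'I_n + (edge_of + 'I_m * bool) :=
  match f with
  | Alpha a i => inl (a, i)
  | Beta e => inr (inl e)
  | Gamma j b => inr (inr (j, b))
  end.
Definition arc_decode (c : bool * 'I_n + (edge_of + 'I_m * bool)) : arc :=
  match c with
  | inl (a, i) => Alpha a i
  | inr (inl e) => Beta e
  | inr (inr (j, b)) => Gamma j b
  end.
Lemma arc_codeK : cancel arc_code arc_decode.
Proof. by case. Qed.
HB.instance Definition _ := Finite.copy arc (can_type arc_codeK).

Definition tail (f : arc) : vertex :=
  match f with
  | Alpha _ _ => Source | Beta e => VS (endS e) | Gamma j _ => VT j
  end.
Definition head (f : arc) : vertex :=
  match f with
  | Alpha _ i => VS i | Beta e => VT (endT e) | Gamma _ _ => Sink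
  end.

Fixpoint is_walk (u v : vertex) (p : seq arc) : bool :=
  if p is f :: p' then (tail f == u) && is_walk (head f) v p' else u == v.

(* G(H) is acyclic, so that directed walks are directed paths. *)
Record route : predArgType :=
  Route { route_arcs :> seq arc; _ : is_walk Source Sink route_arcs }.

HB.instance Definition _ := [isSub for route_arcs].
HB.instance Definition _ := [Countable of route by <:].

Lemma abg_subproof (a : bool) (e : edge_of) (b : bool) :
  is_walk Source Sink [:: Alpha a (endS e); Beta e; Gamma (endT e) b].
Proof. by rewrite /= !eqxx. Qed.

Definition abg (a : bool) (e : edge_of) (b : bool) : route :=
  Route (abg_subproof a e b).

Lemma routeP (r : route) : exists a e b, r = abg a e b.
Proof.
case: r => p wp.
suff [a [e [b ep]]] : exists a e b,
    p = [:: Alpha a (endS e); Beta e; Gamma (endT e) b].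
  by exists a, e, b; apply: val_inj.
case: p wp => [/eqP //|f p /andP[/eqP + wp]].
case: f wp => [a i|//|//] /= wp _; case: p wp => [/eqP //|f p /andP[/eqP + wp]].
case: f wp => [//|e|//] /= wp [<-]; case: p wp => [/eqP //|f p /andP[/eqP + wp]].
case: f wp => [//|//|j b] /= wp [->]; exists a, e, b.
by case: p wp => [//|f p /andP[/eqP]]; case: f.
Qed.

Definition route_code (r : route) : option (bool * edge_of * bool) :=
  if route_arcs r is [:: Alpha a _; Beta e; Gamma _ b] then Some (a, e, b)
  else None.
Definition route_decode (c : option (bool * edge_of * bool)) : option route :=
  omap (fun x => abg x.1.1 x.1.2 x.2) c.
Lemma route_codeK : pcancel route_code route_decode.
Proof. by move=> r; have [a [e [b ->]]] := routeP r. Qed.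
HB.instance Definition _ : isFinite route := PCanIsFinite route_codeK.

(* [frame_in f g] (resp. [frame_out f g]): f and g enter (resp. leave) the same
   inner vertex and f precedes g there.  Booleans are compared as integers. *)
Definition frame_in (f g : arc) : bool :=
  match f, g with
  | Alpha a i, Alpha a' i' => (i == i') && (a < a')
  | Beta e, Beta e' => (endT e == endT e') && (endS e < endS e')
  | _, _ => false
  end.
Definition frame_out (f g : arc) : bool :=
  match f, g with
  | Beta e, Beta e' => (endS e == endS e') && (endT e < endT e')
  | Gamma j b, Gamma j' b' => (j == j') && (b < b')
  | _, _ => false
  end.

(* Conflict of paths for a framing: p and q share a maximal common subpath c
   (possibly reduced to one inner vertex), which p enters before q and leaves
   after q.  [crosses_abg] makes this explicit for the canonical framing. *)
Definition crosses (p q : seq arc) : Prop :=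
  exists x f c g y x' f' g' y',
    [/\ p = x ++ f :: c ++ g :: y, q = x' ++ f' :: c ++ g' :: y',
        frame_in f f' & frame_out g' g].

Definition incoherent (r q : route) : Prop := crosses r q \/ crosses q r.

Definition coherent (r q : route) : Prop := ~ incoherent r q.

Lemma crosses_abg (a b a' b' : bool) (e e' : edge_of) :
  crosses (abg a e b) (abg a' e' b') <->
  [\/ [/\ e = e', (a, b) = (false, true) & (a', b') = (true, false)],
      [/\ endS e = endS e', (a, a') = (false, true) & endT e' < endT e]
    | [/\ endT e = endT e', (b, b') = (true, false) & endS e < endS e']].
Proof.
split.
- case=> x [f [c [g [y [x' [f' [g' [y' [/= Ep Eq]]]]]]]]].
  have dec (w : route) u h c1 k v : route_arcs w = u ++ h :: c1 ++ k :: v ->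
      exists s0 s1 s2, route_arcs w = [:: s0; s1; s2] /\
      [\/ [/\ h = s0, c1 = [::] & k = s1], [/\ h = s0, c1 = [:: s1] & k = s2]
        | [/\ h = s1, c1 = [::] & k = s2]].
    have [a0 [e0 [b0 ->]]] := routeP w => /= E.
    exists (Alpha a0 (endS e0)), (Beta e0), (Gamma (endT e0) b0); split=> //.
    case: u E => [|u0 [|u1 [|u2 [|u3 u]]]] //=.
    + case: c1 => [|c0 [|c1 [|c2 c3]]] //= [<- <-]; first by constructor 1.
      by move=> <- _; constructor 2.
    + by case: c1 => [|c0 [|c1 c2]] //= [_ <- <- _]; constructor 3.
    + by case: c1.
  have [s0 [s1 [s2 [[<- <- <-] D1]]]] := dec (abg a e b) _ _ _ _ _ Ep.
  have [t0 [t1 [t2 [[<- <- <-] D2]]]] := dec (abg a' e' b') _ _ _ _ _ Eq.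
  move: D2; case: D1 => -[-> -> ->] [] [-> Ec ->] //=.
  + case/andP=> /eqP ES la /andP[_ lT]; constructor 2; split=> //.
    by case: (a) (a') la => [] [].
  + case: Ec => -> /andP[_ la] /andP[_ lb]; constructor 1; split=> //.
      by case: (a) (a') la (b) (b') lb => [] [] // _ [] [].
    by case: (a) (a') la (b) (b') lb => [] [] // _ [] [].
  + case/andP=> /eqP ET lS /andP[_ lb]; constructor 3; split=> //.
    by case: (b) (b') lb => [] [].
- case=> -[].
  + move=> <- [-> ->] [-> ->].
    exists [::], (Alpha false (endS e)), [:: Beta e], (Gamma (endT e) true), [::].
    exists [::], (Alpha true (endS e)), (Gamma (endT e) false), [::].
    by split; rewrite //= eqxx.
  + move=> ES [-> ->] lT.
    exists [::], (Alpha false (endS e)), [::], (Beta e), [:: Gamma (endT e) b].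
    exists [::], (Alpha true (endS e')), (Beta e'), [:: Gamma (endT e') b'].
    by split; rewrite //= ES eqxx.
  + move=> ET [-> ->] lS.
    exists [:: Alpha a (endS e)], (Beta e), [::], (Gamma (endT e) true), [::].
    exists [:: Alpha a' (endS e')], (Beta e'), (Gamma (endT e') false), [::].
    by split; rewrite //= ET eqxx.
Qed.

Definition clique (C : {set route}) : Prop :=
  forall r q, r \in C -> q \in C -> coherent r q.

Definition maximal_clique (C : {set route}) : Prop :=
  clique C /\ forall D : {set route}, clique D -> C \subset D -> D = C.

(* The three components are (a_i) for i in S, (a_j) for j in T, and (a_{i,j})
   for ij in E(H), where the signs + and - are true and false. *)
Definition clique_vector_axiom
    (a : {ffun 'I_n -> 'I_m} * {ffun 'I_m -> 'I_n} * {ffun edge_of -> bool}) :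
    bool :=
  [&& [forall i, a.1.1 i \in nbhS i],
      [forall j, a.1.2 j \in nbhT j] &
      [forall e, a.2 e ==>
         (a.1.1 (endS e) == endT e) && (a.1.2 (endT e) == endS e)]].

Record clique_vector : predArgType := CliqueVector {
  clique_vector_val :
    {ffun 'I_n -> 'I_m} * {ffun 'I_m -> 'I_n} * {ffun edge_of -> bool};
  _ : clique_vector_axiom clique_vector_val }.

HB.instance Definition _ := [isSub for clique_vector_val].
HB.instance Definition _ := [Finite of clique_vector by <:].

Definition cvS (a : clique_vector) (i : 'I_n) : 'I_m :=
  (clique_vector_val a).1.1 i.
Definition cvT (a : clique_vector) (j : 'I_m) : 'I_n :=
  (clique_vector_val a).1.2 j.
Definition cvE (a : clique_vector) (e : edge_of) : bool :=
  (clique_vector_val a).2 e.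

(* The pairs (x, y) such that alpha_{x,i} beta_{i,j} gamma_{j,y} belongs to the
   image of a, where e = ij. *)
Definition phi_labels (a : clique_vector) (e : edge_of) : seq (bool * bool) :=
  let i := endS e in
  let j := endT e in
  match cvS a i == j, cvT a j == i with
  | false, false => [:: (cvS a i < j, cvT a j < i)]
  | true, false =>
      if cvT a j < i then [:: (false, true); (true, true)]
      else [:: (false, false); (true, false)]
  | false, true =>
      if cvS a i < j then [:: (true, false); (true, true)]
      else [:: (false, false); (false, true)]
  | true, true =>
      if cvE a e then [:: (false, false); (true, false); (true, true)]
      else [:: (false, false); (false, true); (true, true)]
  end.

Definition clique_map (a : clique_vector) : {set route} :=
  \bigcup_(e : edge_of) [set abg xy.1 e xy.2 | xy in phi_labels a e].

End BipartiteGraph.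

(* Main.v *)
Require Import Defs.
From mathcomp Require Import all_boot.

(** At a vertex [v], a set of routes is free of conflicts of type (b) or (c)
    exactly when the neighbours reached through the first label at [v] all lie
    weakly below those reached through the second one.  The entry [a_v] of a
    clique vector is a neighbour separating these two sets, and the sign
    [a_{i,j}] decides which of the two routes in conflict (a) is kept.  In
    [phi a] the neighbour [a_v] is reached through both labels; hence it is the
    only separator, and every route coherent with [phi a] respects it. *)

Set Implicit Arguments.
Unset Strict Implicit.
Unset Printing Implicit Defensive.

(** The largest element of [A] separates; if [A] is empty, the smallest element of [N] does. *)
Lemma exists_separator (m : nat) (N A B : {set 'I_m}) :
    N != set0 -> A \subset N -> B \subset N ->
    (forall x y, x \in A -> y \in B -> x <= y) ->
  exists k, [/\ k \in N, forall x, x \in A -> x <= k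
                       & forall y, y \in B -> k <= y].
Proof.
case/set0Pn=> k0 Nk0 /subsetP sAN /subsetP sBN leAB.
case: (set_0Vmem A) => [A0|[x0 Ax0]].
  case: (arg_minnP (fun i : 'I_m => i : nat) Nk0) => k Nk mink.
  exists k; split=> // [x|y /sBN]; last exact: mink.
  by rewrite A0 inE.
case: (arg_maxnP (fun i : 'I_m => i : nat) Ax0) => k Ak maxk.
by exists k; split=> [|x Ax|y By]; [exact: sAN | exact: maxk | exact: leAB].
Qed.

Section CliqueMap.

Variables (n m : nat) (H : bipartite_graph n m).
Implicit Types (a c : clique_vector H) (e : edge_of H) (C D : {set route H}).

(** The clauses exclude the conflicts (a), (b) and (c) in turn; for (b) and (c) the excluded strict
    inequality is turned into the opposite weak one. *)
Lemma cliqueP C :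
  clique C <->
  [/\ forall e, abg false e true \in C -> abg true e false \in C -> False,
      forall e e' y y', endS e = endS e' ->
        abg false e y \in C -> abg true e' y' \in C -> endT e <= endT e'
    & forall e e' x x', endT e = endT e' ->
        abg x e false \in C -> abg x' e' true \in C -> endS e <= endS e'].
Proof.
split=> [cC|[cE cS cT]].
  split=> [e C1 C2|e e' y y' ES C1 C2|e e' x x' ET C1 C2].
  - by apply: (cC _ _ C1 C2); left; apply/crosses_abg; constructor 1.
  - rewrite leqNgt; apply/negP=> lt.
    by apply: (cC _ _ C1 C2); left; apply/crosses_abg; constructor 2.
  - rewrite leqNgt; apply/negP=> lt.
    by apply: (cC _ _ C2 C1); left; apply/crosses_abg; constructor 3.
suff ncr r q : r \in C -> q \in C -> ~ crosses r q.
  by move=> r q rC qC []; apply: ncr.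
have [x [e [y ->]]] := routeP r; have [x' [e' [y' ->]]] := routeP q.
move=> rC qC /crosses_abg[] [].
- move=> Ee [Ex Ey] [Ex' Ey']; subst.
  exact: cE rC qC.
- move=> ES [Ex Ex']; subst.
  by rewrite ltnNge (cS _ _ _ _ ES rC qC).
- move=> ET [Ey Ey']; subst.
  by rewrite ltnNge (cT _ _ _ _ (esym ET) qC rC).
Qed.

(** With [p] the separator at a vertex, this says that label [x] is allowed there on the edge to the
    neighbour [q]. Both labels are allowed when [q] is [p]. *)
Definition on_side (x : bool) (p q : nat) : bool :=
  if x then p <= q else q <= p.

Lemma on_side_refl x p : on_side x p p.
Proof. by case: x => /=. Qed.

Lemma abg_inj x e y x' e' y' :
  abg x e y = abg x' e' y' -> [/\ x = x', e = e' & y = y'].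
Proof. by move/(congr1 (@route_arcs n m H)) => [-> _ -> _ ->]. Qed.

(** This unifies the cases of the clique map: each label must lie on its side of the separator. On
    an edge selected from both ends all four label pairs do, and the sign keeps one of the two
    conflicting pairs, the one with [x = cvE a e]. *)
Lemma mem_clique_map a x e y :
  (abg x e y \in clique_map a) =
  [&& on_side x (cvS a (endS e)) (endT e), on_side y (cvT a (endT e)) (endS e)
    & (cvS a (endS e) == endT e) && (cvT a (endT e) == endS e) ==>
      (x == y) || (x == cvE a e)].
Proof.
transitivity ((x, y) \in phi_labels a e).
  apply/bigcupP/idP=> [[e' _ /imsetP[[x' y'] + /abg_inj[-> -> ->]]] //|xy].
  by exists e => //; apply/imsetP; exists (x, y).
rewrite /phi_labels /on_side -!val_eqE /=.
case: (ltngtP (cvS a (endS e)) (endT e)) => _;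
  case: (ltngtP (cvT a (endT e)) (endS e)) => _ //=;
  by case: x; case: y; case: (cvE a e).
Qed.

Lemma cvS_nbh a i : (i, cvS a i) \in H.
Proof. by case/and3P: (valP a) => /forallP/(_ i); rewrite inE. Qed.

Lemma cvT_nbh a j : (cvT a j, j) \in H.
Proof. by case/and3P: (valP a) => _ /forallP/(_ j); rewrite inE. Qed.

Lemma cvE_compat a e :
  cvE a e -> (cvS a (endS e) = endT e) /\ (cvT a (endT e) = endS e).
Proof.
by case/and3P: (valP a) => _ _ /forallP/(_ e)/implyP h /h /andP[/eqP ? /eqP ?].
Qed.

Lemma clique_map_S a i x :
  exists e y, [/\ endS e = i, endT e = cvS a i & abg x e y \in clique_map a].
Proof.
pose e : edge_of H := exist _ (i, cvS a i) (cvS_nbh a i).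
(* If the edge is selected from both ends, equal labels survive whatever the sign; otherwise the
   label at the far end is dictated by the side on which its separator lies. *)
have [iT|iT] := eqVneq (cvT a (cvS a i)) i.
  by exists e, x; split=> //; rewrite mem_clique_map /= iT !on_side_refl !eqxx.
exists e, (cvT a (cvS a i) < i); split=> //.
rewrite mem_clique_map /= on_side_refl (negbTE iT) andbF andbT /=.
by move: iT; rewrite -val_eqE /on_side /=; case: ltngtP.
Qed.

Lemma clique_map_T a j y :
  exists e x, [/\ endT e = j, endS e = cvT a j & abg x e y \in clique_map a].
Proof.
pose e : edge_of H := exist _ (cvT a j, j) (cvT_nbh a j).
have [jS|jS] := eqVneq (cvS a (cvT a j)) j.
  by exists e, y; split=> //; rewrite mem_clique_map /= jS !on_side_refl !eqxx.
exists e, (cvS a (cvT a j) < j); split=> //.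
rewrite mem_clique_map /= on_side_refl (negbTE jS) andbT /=.
by move: jS; rewrite -val_eqE /on_side /=; case: ltngtP.
Qed.

Lemma clique_map_clique a : clique (clique_map a).
Proof.
apply/cliqueP; split=> [e|e e' y y' ES|e e' x x' ET]; rewrite !mem_clique_map /=.
- case/and3P=> h1 h2 h3 /and3P[h4 h5 h6].
  (* Two routes in conflict (a) use both labels at both ends, so the edge is selected from both ends
     and the sign rejects one of them. *)
  have E1 : cvS a (endS e) = endT e by apply/val_inj/anti_leq/andP.
  have E2 : cvT a (endT e) = endS e by apply/val_inj/anti_leq/andP.
  by move: h3 h6; rewrite E1 E2 !eqxx; case: (cvE a e).
- by case/and3P=> h1 _ _ /and3P[h2 _ _]; rewrite (leq_trans h1) // ES.
- by case/and3P=> _ h1 _ /and3P[_ h2 _]; rewrite (leq_trans h1) // ET.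
Qed.

Lemma clique_map_maximal a : maximal_clique (clique_map a).
Proof.
split=> [|D /cliqueP[cE cS cT] /subsetP sD]; first exact: clique_map_clique.
apply/eqP; rewrite eqEsubset; apply/andP; split; last exact/subsetP.
apply/subsetP=> r; have [x [e [y ->]]] := routeP r => rD.
rewrite mem_clique_map; apply/and3P; split.
(* Coherence with the route through the separator carrying the opposite label puts the new route on
   the correct side. *)
- have [e' [y' [ES <- /sD]]] := clique_map_S a (endS e) (~~ x).
  by case: x rD => /= rD r'D; [apply: cS ES r'D rD | apply: cS (esym ES) rD r'D].
- have [e' [x' [ET <- /sD]]] := clique_map_T a (endT e) (~~ y).
  by case: y rD => /= rD r'D; [apply: cT ET r'D rD | apply: cT (esym ET) rD r'D].
apply/implyP=> /andP[/eqP iS /eqP iT].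
(* This is the route of the conflicting pair retained by the sign; a route violating the last
   condition would be its rival. *)
have keep z : z = cvE a e -> abg z e (~~ z) \in D.
  move=> ->; apply: sD.
  by rewrite mem_clique_map iS iT !on_side_refl !eqxx orbT.
move: rD (keep _ erefl).
by case: x; case: y; case: (cvE a e) => //= h1 h2; case: (cE e).
Qed.

Lemma clique_map_inj : injective (@clique_map n m H).
Proof.
move=> a c eqac.
have eqS i : cvS a i = cvS c i.
  (* In the common image the separator of [a] is reached through label 1, hence lies weakly below
     that of [c], and through label 2, hence weakly above. *)
  apply/val_inj/anti_leq/andP; split.
    have [e [y [ES <-]]] := clique_map_S a i false.
    by rewrite eqac mem_clique_map ES => /andP[].
  have [e [y [ES <-]]] := clique_map_S a i true.
  by rewrite eqac mem_clique_map ES => /andP[].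
have eqT j : cvT a j = cvT c j.
  apply/val_inj/anti_leq/andP; split.
    have [e [x [ET <-]]] := clique_map_T a j false.
    by rewrite eqac mem_clique_map ET => /and3P[].
  have [e [x [ET <-]]] := clique_map_T a j true.
  by rewrite eqac mem_clique_map ET => /and3P[].
(* The two routes with equal labels force [a2] to select [e] from both ends; the third route then
   forces the sign +. *)
have subE a1 a2 e : clique_map a1 = clique_map a2 -> cvE a1 e -> cvE a2 e.
  move=> eq12 a1e; have [iS iT] := cvE_compat a1e.
  have in1 : abg true e false \in clique_map a1.
    by rewrite mem_clique_map iS iT !on_side_refl !eqxx a1e.
  have in1' x : abg x e x \in clique_map a1.
    by rewrite mem_clique_map iS iT !on_side_refl !eqxx.
  move: (in1' false) (in1' true) in1; rewrite eq12 !mem_clique_map /=.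
  case/and3P=> h1 h2 _ /and3P[h3 h4 _] /and3P[_ _].
  have -> : cvS a2 (endS e) = endT e by apply/val_inj/anti_leq/andP.
  have -> : cvT a2 (endT e) = endS e by apply/val_inj/anti_leq/andP.
  by rewrite !eqxx; case: (cvE a2 e).
have eqE e : cvE a e = cvE c e by apply/idP/idP; apply: subE.
apply: val_inj; move: eqS eqT eqE; rewrite /cvS /cvT /cvE /=.
case: (clique_vector_val a) => [[aS aT] aE].
case: (clique_vector_val c) => [[cS cT] cE] /= eqS eqT eqE.
by congr (_, _, _); apply/ffunP.
Qed.

Lemma clique_sub_clique_map C :
    (forall i, nbhS H i != set0) -> (forall j, nbhT H j != set0) ->
  clique C -> exists a, C \subset clique_map a.
Proof.
move=> nzS nzT /cliqueP[cE cS cT].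
have sepS i : exists k, k \in nbhS H i /\
    forall x e y, endS e = i -> abg x e y \in C -> on_side x k (endT e).
  (* The neighbours of [i] reached through label [x] by routes of [C]. *)
  pose X x := [set j | [exists e, [exists y,
    [&& endS e == i, endT e == j & abg x e y \in C]]]].
  have XP x j : reflect
      (exists e y, [/\ endS e = i, endT e = j & abg x e y \in C]) (j \in X x).
    rewrite inE; apply: (iffP existsP) => [[e /existsP[y /and3P[/eqP ? /eqP ?]]]|].
      by exists e, y.
    case=> e [y [<- <- ey]]; exists e; apply/existsP; exists y.
    by rewrite !eqxx.
  have sX x : X x \subset nbhS H i.
    apply/subsetP=> j /XP[[[i' j'] e] [y [<- <- _]]]; by rewrite inE.
  have [j j' /XP[e [y [ES <- ey]]] /XP[e' [y' [ES' <- ey']]]|k [Nk lek gek]] :=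
    exists_separator (nzS i) (sX false) (sX true).
    by apply: cS ey ey'; rewrite ES.
  exists k; split=> // x e y ES ey; have jX : endT e \in X x.
    by apply/XP; exists e, y.
  by case: x {ey} jX => [/gek|/lek].
have sepT j : exists k, k \in nbhT H j /\
    forall x e y, endT e = j -> abg x e y \in C -> on_side y k (endS e).
  pose Y y := [set i | [exists e, [exists x,
    [&& endT e == j, endS e == i & abg x e y \in C]]]].
  have YP y i : reflect
      (exists e x, [/\ endT e = j, endS e = i & abg x e y \in C]) (i \in Y y).
    rewrite inE; apply: (iffP existsP) => [[e /existsP[x /and3P[/eqP ? /eqP ?]]]|].
      by exists e, x.
    case=> e [x [<- <- ex]]; exists e; apply/existsP; exists x.
    by rewrite !eqxx.
  have sY y : Y y \subset nbhT H j.
    apply/subsetP=> i /YP[[[i' j'] e] [x [<- <- _]]]; by rewrite inE.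
  have [i i' /YP[e [x [ET <- ex]]] /YP[e' [x' [ET' <- ex']]]|k [Nk lek gek]] :=
    exists_separator (nzT j) (sY false) (sY true).
    by apply: cT ex ex'; rewrite ET.
  exists k; split=> // x e y ET ey; have iY : endS e \in Y y.
    by apply/YP; exists e, x.
  by case: y {ey} iY => [/gek|/lek].
have [fS fSP] := fin_all_exists sepS.
have [fT fTP] := fin_all_exists sepT.
(* The sign is + only where [C] contains the route with labels 2, 1; if [C] contains neither
   conflicting route, the default - is harmless. *)
pose v : {ffun 'I_n -> 'I_m} * {ffun 'I_m -> 'I_n} * {ffun edge_of H -> bool} :=
  ([ffun i => fS i], [ffun j => fT j],
   [ffun e => [&& fS (endS e) == endT e, fT (endT e) == endS e
                & abg true e false \in C]]).
have vP : clique_vector_axiom v.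
  apply/and3P; split; apply/forallP=> z; rewrite /v /= !ffunE.
  - by case: (fSP z).
  - by case: (fTP z).
  - by apply/implyP=> /and3P[-> ->].
exists (CliqueVector vP); apply/subsetP=> r.
have [x [e [y ->]]] := routeP r => rC.
rewrite mem_clique_map /cvS /cvT /cvE /v /= !ffunE.
have [_ /(_ _ _ _ erefl rC) ->] := fSP (endS e).
have [_ /(_ _ _ _ erefl rC) ->] /= := fTP (endT e).
apply/implyP=> /andP[-> ->] /=.
(* Only labels 1, 2 remain: such a route in [C] excludes its rival, so the sign is -. *)
case: x rC; case: y => // rC.
by apply/orP; right; apply/eqP/esym/negP/(cE _ rC).
Qed.

End CliqueMap.

Theorem theorem3p6 (n m : nat) (H : bipartite_graph n m)
    (degS : forall i : 'I_n, #|nbhS H i| <> 0 /\ #|nbhS H i| <> 1)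
    (degT : forall j : 'I_m, #|nbhT H j| <> 0 /\ #|nbhT H j| <> 1) :
  (forall a : clique_vector H, maximal_clique (clique_map a)) /\
  injective (@clique_map n m H) /\
  (forall C : {set route H}, maximal_clique C ->
     exists a : clique_vector H, clique_map a = C).
Proof.
split; first exact: clique_map_maximal.
split=> [|C [cC maxC]]; first exact: clique_map_inj.
(* Nonzero degrees give nonempty neighbourhoods; a maximal clique inside the clique [clique_map a]
   must equal it. *)
have [i|j|a sCa] := @clique_sub_clique_map _ _ H C _ _ cC.
- by rewrite -cards_eq0; case: (degS i) => /eqP.
- by rewrite -cards_eq0; case: (degT j) => /eqP.
by exists a; apply: maxC sCa; exact: clique_map_clique.
Qed.
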